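(* Infinitesimal deformations of a canonical element $\pi$ of a $\mathbb{Z}^n$-graded Lie algebra $(V,\{-,-\})$ are classified up to first order equivalence by $H_\pi^{\deg(\pi)}(V)$; that is, $\pi+\nu\pi_1\mapsto[\pi_1]$ induces a bijection between the set of infinitesimal deformations of $\pi$ modulo equivalence up to order $1$ and $H_\pi^{\deg(\pi)}(V)$.
   Context: All vector spaces are over a field $\mathbb{K}$ of characteristic $0$. For $\alpha,\beta\in\mathbb{Z}^n$ ($n\ge 1$), $\langle\alpha,\beta\rangle=\sum_i\alpha_i\beta_i$. A $\mathbb{Z}^n$-graded Lie algebra is a $\mathbb{Z}^n$-graded vector space $V=\bigoplus_{\alpha\in\mathbb{Z}^n} V^\alpha$ with a bilinear bracket of weight $0$ such that $\{a,b\}=-(-1)^{\langle a,b\rangle}\{b,a\}$ and $\{a,\{b,c\}\}=\{\{a,b\},c\}+(-1)^{\langle a,b\rangle}\{b,\{a,c\}\}$ for homogeneous $a,b,c$ (in exponents, a homogeneous element stands for its degree). A homogeneous element $w$ is odd if $\langle w,w\rangle$ is odd. A canonical element is an odd element $\pi\in V$ with $\{\pi,\pi\}=0$; then $\partial_\pi:=\{\pi,-\}$ squares to zero, and $H^\alpha_\pi(V)=\ker(\partial_\pi|_{V^\alpha})/\partial_\pi(V^{\alpha-\deg\pi})$. An infinitesimal deformation of $\pi$ is a formal deformation of order $1$, i.e. $\pi_\nu=\pi+\nu\pi_1$ with $\pi_1\in V^{\deg(\pi)}$ and $\{\pi,\pi_1\}+\{\pi_1,\pi\}=0$. Two deformations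 $\pi_\nu,\pi'_\nu$ are equivalent up to order $1$ if there is a series $\chi_\nu=\sum_{i\ge1}\nu^i\chi_i\in V^0[[\nu]]$ with $\exp(\mathrm{ad}\,\chi_\nu)\pi_\nu=\pi'_\nu+\mathcal{O}(\nu^2)$, where $\mathrm{ad}\,\chi_\nu=\{\chi_\nu,-\}$ (bracket extended $\nu$-bilinearly). *)

(* Defs.v *)
From HB Require Import structures.
From mathcomp Require Import all_boot all_order all_algebra.
From mathcomp Require Import boolp.

Set Implicit Arguments.
Unset Strict Implicit.
Unset Printing Implicit Defensive.

Import GRing.Theory.
Local Open Scope ring_scope.

Definition pairing (n : nat) (a b : 'rV[int]_n) : int :=
  \sum_(i < n) a 0 i * b 0 i.

(* The grading is internal: [homog V a] is the subspace V^a of the total      *)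
(* space V. [homog_span] and [homog_indep] together say that V is the direct  *)
(* sum of the V^a.                                                            *)
Record gradedLieAlgebra (K : fieldType) (n : nat) := GradedLieAlgebra {
  carrier :> lmodType K;
  homog : 'rV[int]_n -> {pred carrier};
  bracket : {bilinear carrier -> carrier -> carrier};
  homog_submod : forall a, submod_closed (homog a);
  homog_span : forall v : carrier,
    exists (s : seq 'rV[int]_n) (f : 'rV[int]_n -> carrier),
      (forall a, f a \in homog a) /\ v = \sum_(a <- s) f a;
  homog_indep : forall (s : seq 'rV[int]_n) (f : 'rV[int]_n -> carrier),
    uniq s -> (forall a, f a \in homog a) ->
    \sum_(a <- s) f a = 0 -> forall a, a \in s -> f a = 0;
  bracket_weight0 : forall a b x y,
    x \in homog a -> y \in homog b -> bracket x y \in homog (a + b);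
  bracket_antisym : forall a b x y,
    x \in homog a -> y \in homog b ->
    bracket x y = - ((-1 : K) ^ pairing a b *: bracket y x);
  bracket_jacobi : forall a b c x y z,
    x \in homog a -> y \in homog b -> z \in homog c ->
    bracket x (bracket y z) =
      bracket (bracket x y) z
      + (-1 : K) ^ pairing a b *: bracket y (bracket x z)
}.

Arguments homog {K n} V a : rename.
Arguments bracket {K n} V : rename.
Arguments homog_submod {K n} V a : rename.

(* The degree is part of the data, since it is not determined when the        *)
(* element is zero.                                                           *)
Record canonicalElement (K : fieldType) (n : nat) (V : gradedLieAlgebra K n) :=
  CanonicalElement {
  canon_val :> V;
  deg : 'rV[int]_n;
  canon_homog : canon_val \in homog V deg;
  canon_odd : odd `|pairing deg deg|%N;
  canon_square0 : bracket V canon_val canon_val = 0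
}.

Section Cohomology.

Variables (K : fieldType) (n : nat) (V : gradedLieAlgebra K n).
Variables (pi : canonicalElement V) (alpha : 'rV[int]_n).

Definition differential (x : V) : V := bracket V pi x.

Definition cocycles : {pred V} :=
  [pred x : V | (x \in homog V alpha) && (differential x == 0)].

Fact cocycles_submod : submod_closed cocycles.
Proof.
have [h0 hD] := homog_submod V alpha.
split=> [|a x y]; first by rewrite inE h0 /differential linear0r eqxx.
rewrite !inE => /andP[xV /eqP dx] /andP[yV /eqP dy].
by rewrite hD //= /differential linearPr /= -!/(differential _) dx dy
  scaler0 addr0 eqxx.
Qed.

HB.instance Definition _ :=
  GRing.isSubmodClosed.Build K V cocycles cocycles_submod.

Record cocycle := Cocycle {
  cocycle_val :> V;
  _ : cocycle_val \in cocycles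
}.

HB.instance Definition _ := [isSub for cocycle_val].
HB.instance Definition _ := [Choice of cocycle by <:].
HB.instance Definition _ := [SubChoice_isSubLmodule of cocycle by <:].

Definition coboundaries : {pred cocycle} :=
  [pred z : cocycle |
     `[< exists2 y : V, y \in homog V (alpha - deg pi) &
           differential y = cocycle_val z >]].

Fact coboundaries_zmod : zmod_closed coboundaries.
Proof.
have [h0 hD] := homog_submod V (alpha - deg pi).
split=> [|z w].
  by apply/asboolP; exists 0; rewrite // /differential linear0r.
move=> /asboolP[x xV dx] /asboolP[y yV dy]; apply/asboolP.
exists (x - y); first by rewrite -[x - y]addrC -scaleN1r hD.
by rewrite /differential linearBr /= -!/(differential _) dx dy.
Qed.

HB.instance Definition _ :=
  GRing.isZmodClosed.Build cocycle coboundaries coboundaries_zmod.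

Definition cohomology := {ideal_quot coboundaries}.

HB.instance Definition _ := GRing.Zmodule.on cohomology.
HB.instance Definition _ := Quotient.on cohomology.

End Cohomology.

(* A sequence f : nat -> V stands for the formal series                       *)
(* \sum_i nu^i (f i) in V[[nu]].                                              *)
Section FormalSeries.

Variables (K : fieldType) (n : nat) (V : gradedLieAlgebra K n).

Definition series_bracket (f g : nat -> V) (k : nat) : V :=
  \sum_(i < k.+1) bracket V (f i) (g (k - i)%N).

Lemma iter_series_bracket_small (chi f : nat -> V) (j k : nat) :
  chi 0%N = 0 -> (k < j)%N -> iter j (series_bracket chi) f k = 0.
Proof.
move=> chi0; elim: j k => // j IHj k ltkj /=.
rewrite /series_bracket big1 // => -[[|i] /= ltik] _.
  by rewrite chi0 linear0l.
rewrite IHj ?linear0r // ltn_subLR // addSn.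
by rewrite (leq_trans ltkj) // ltnS leq_addl.
Qed.

(* When chi has no constant term, (ad chi)^j f has order at least j, so the   *)
(* exponential series is coefficientwise finite and its nu^k coefficient only *)
(* involves the powers j <= k.                                                *)
Definition exp_ad (chi f : nat -> V) (k : nat) : V :=
  \sum_(j < k.+1) (j`!%:R : K)^-1 *: iter j (series_bracket chi) f k.

Definition eq_up_to_order (m : nat) (f g : nat -> V) : Prop :=
  forall k, (k <= m)%N -> f k = g k.

Definition equivalent_up_to_order (m : nat) (f g : nat -> V) : Prop :=
  exists chi : nat -> V,
    [/\ chi 0%N = 0, forall i, chi i \in homog V 0
      & eq_up_to_order m (exp_ad chi f) g].

End FormalSeries.

Section Deformations.

Variables (K : fieldType) (n : nat) (V : gradedLieAlgebra K n).
Variable pi : canonicalElement V.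

(* The deformation pi + nu pi_1 is recorded by its coefficient pi_1.          *)
Record infinitesimalDeformation := InfinitesimalDeformation {
  deform_coef : V;
  _ : (deform_coef \in homog V (deg pi)) &&
      (bracket V pi deform_coef + bracket V deform_coef pi == 0)
}.

HB.instance Definition _ := [isSub for deform_coef].
HB.instance Definition _ := [Choice of infinitesimalDeformation by <:].

Definition deform_series (p : infinitesimalDeformation) (k : nat) : V :=
  match k with
  | 0 => canon_val pi
  | 1 => deform_coef p
  | _ => 0
  end.

Definition deform_equiv (p q : infinitesimalDeformation) : bool :=
  `[< equivalent_up_to_order 1 (deform_series p) (deform_series q) >].

Fact deform_equivP p q :
  reflect (exists2 x : V, x \in homog V 0 &
             deform_coef p + bracket V x pi = deform_coef q)
          (deform_equiv p q).
Proof.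
have E0 (chi : nat -> V) : exp_ad chi (deform_series p) 0 = pi.
  by rewrite /exp_ad big_ord1 /= fact0 invr1 scale1r.
have E1 (chi : nat -> V) : chi 0%N = 0 ->
    exp_ad chi (deform_series p) 1 = deform_coef p + bracket V (chi 1%N) pi.
  move=> chi0; rewrite /exp_ad !big_ord_recl big_ord0 /= !invr1 !scale1r addr0.
  rewrite /series_bracket !big_ord_recl big_ord0 /= chi0 linear0l.
  by rewrite add0r addr0.
rewrite /deform_equiv.
apply: (iffP (asboolP _)) => [[chi [chi0 chiV eqpq]]|[x xV eqpq]].
  by exists (chi 1%N) => //; rewrite -E1 // eqpq.
exists (fun k => if k == 1%N then x else 0); split=> // [i|].
- by case: eqP => // _; have [] := homog_submod V 0.
- by case=> [|[|]] // _; rewrite ?E0 ?E1.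
Qed.

Fact deform_equiv_refl : reflexive deform_equiv.
Proof.
move=> p; apply/deform_equivP; exists 0; last by rewrite linear0l addr0.
by have [] := homog_submod V 0.
Qed.

Fact deform_equiv_sym : symmetric deform_equiv.
Proof.
have [h0 hD] := homog_submod V 0.
suff sub p q : deform_equiv p q -> deform_equiv q p.
  by move=> p q; apply/idP/idP; apply: sub.
move=> /deform_equivP[x xV eqpq]; apply/deform_equivP; exists (- x).
  by rewrite -[- x]addr0 -scaleN1r hD.
by rewrite linearNl -eqpq addrK.
Qed.

Fact deform_equiv_trans : transitive deform_equiv.
Proof.
have [h0 hD] := homog_submod V 0.
move=> q p r /deform_equivP[x xV eqpq] /deform_equivP[y yV eqqr].
apply/deform_equivP; exists (x + y); first by rewrite -[x]scale1r hD.
by rewrite linearDl addrA eqpq.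
Qed.

Canonical deform_equiv_rel :=
  EquivRel deform_equiv deform_equiv_refl deform_equiv_sym deform_equiv_trans.

Definition deformation_classes := {eq_quot deform_equiv_rel}%qT.

HB.instance Definition _ := Quotient.on deformation_classes.
HB.instance Definition _ := Choice.on deformation_classes.

End Deformations.

(* Main.v *)
Require Import Defs.
From mathcomp Require Import all_boot all_order all_algebra.
From mathcomp Require Import boolp.
Import GRing.Theory.
Local Open Scope ring_scope.

(** The deformations of [pi] and the cocycles of degree [deg pi] are the same
    elements [p] of V, and the two equivalence relations on them coincide, so
    the quotient sets are in bijection ([quotient_bijection]).

    As [pi] is odd, [{p, pi} = {pi, p}] for [p] of degree [deg pi], hence the
    deformation equation reads [2 {pi, p} = 0]; since 2 is invertible in
    characteristic 0, it says that [p] is a cocycle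
    ([deformation_eq_cocycle]).

    The coefficient of nu in [exp (ad chi) (pi + nu p)] is
    [p + {chi_1, pi}], and [{chi_1, pi} = - {pi, chi_1}] because [chi_1] has
    degree 0. So a first order equivalence from [p] to [q] is the same thing
    as a cochain [chi_1] of degree [0 = deg pi - deg pi] with
    [p - q = d chi_1] ([deform_equiv_eq_coboundary]). *)

(** A bijection of the underlying sets that transports one equivalence
    relation to the other one descends to the quotients. *)
Lemma quotient_bijection {T U : Type} (qT : quotType T) (qU : quotType U)
    (f : T -> U) :
  bijective f ->
  (forall x y : T,
     \pi_qT x = \pi_qT y <-> \pi_qU (f x) = \pi_qU (f y))%qT ->
  exists Phi : qT -> qU,
    bijective Phi /\ forall x : T, Phi (\pi_qT x)%qT = (\pi_qU (f x))%qT.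
Proof.
move=> [g fK gK] f_equiv.
pose Phi (u : qT) : qU := (\pi_qU (f (repr u)))%qT.
pose Psi (v : qU) : qT := (\pi_qT (g (repr v)))%qT.
have Phi_pi x : Phi (\pi_qT x)%qT = (\pi_qU (f x))%qT.
  by apply/f_equiv; rewrite reprK.
exists Phi; split=> //; exists Psi => [u|v]; last by rewrite Phi_pi gK reprK.
by rewrite -[RHS]reprK; apply/f_equiv; rewrite gK reprK.
Qed.

Section GradedLieAlgebra.

Context {K : fieldType} {n : nat} {V : gradedLieAlgebra K n}.

Lemma bracketC_odd {a b : 'rV[int]_n} {x y : V} :
  odd `|pairing a b|%N -> x \in homog V a -> y \in homog V b ->
  bracket V x y = bracket V y x.
Proof.
move=> ab_odd xV yV; rewrite (bracket_antisym xV yV).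
suff -> : (-1 : K) ^ pairing a b = -1 by rewrite scaleN1r opprK.
case: (pairing a b) ab_odd => m m_odd; first by rewrite -exprnP -signr_odd m_odd.
by rewrite NegzE -exprnN -signr_odd m_odd expr1 invrN1.
Qed.

Lemma bracketC_degree0 {b : 'rV[int]_n} {x y : V} :
  x \in homog V 0 -> y \in homog V b -> bracket V x y = - bracket V y x.
Proof.
move=> xV yV; rewrite (bracket_antisym xV yV) /pairing big1 ?expr0z ?scale1r //.
by move=> i _; rewrite mxE mul0r.
Qed.

Context { pi : canonicalElement V}.

(** Oddness of [pi] makes the two summands of the deformation equation
    equal. *)
Lemma deformation_eq_cocycle (charK : [pchar K] =i pred0) (p : V) :
  (p \in homog V (deg pi)) && (bracket V pi p + bracket V p pi == 0)
    = (p \in cocycles pi (deg pi)).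
Proof.
rewrite [RHS]inE; apply: andb_id2l => pV.
rewrite -(bracketC_odd (canon_odd pi) (canon_homog pi) pV).
rewrite -mulr2n -scaler_nat scaler_eq0.
by have /pcharf0P -> := charK.
Qed.

(** The parameter of an equivalence has degree 0, where the bracket is
    antisymmetric: this accounts for [p] and [q] being exchanged between
    [p + {x, pi} = q] and [{pi, x} = p - q]. *)
Lemma deform_equiv_eq_coboundary (p q : infinitesimalDeformation pi)
    (z w : cocycle pi (deg pi)) :
  cocycle_val z = deform_coef p -> cocycle_val w = deform_coef q ->
  deform_equiv p q = (z - w \in @coboundaries _ _ _ pi (deg pi)).
Proof.
move=> zp wq.
have zw : cocycle_val (z - w) = deform_coef p - deform_coef q.
  by rewrite -zp -wq.
apply/deform_equivP/asboolP; rewrite subrr zw => -[x xV].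
  move=> <-; exists x => //.
  by rewrite (bracketC_degree0 xV (canon_homog pi)) opprB addrC subrK.
rewrite /differential => dx; exists x => //.
by rewrite (bracketC_degree0 xV (canon_homog pi)) dx opprB addrC subrK.
Qed.

End GradedLieAlgebra.

Theorem proposition3 (K : fieldType) (charK : [pchar K] =i pred0)
    (n : nat) (n_gt0 : (0 < n)%N)
    (V : gradedLieAlgebra K n) (pi : canonicalElement V) :
  exists Phi : deformation_classes pi -> cohomology pi (deg pi),
    bijective Phi /\
    forall p : infinitesimalDeformation pi,
      exists2 z : cocycle pi (deg pi),
        cocycle_val z = deform_coef p &
        Phi (\pi_(deformation_classes pi) p)%qT
          = (\pi_(cohomology pi (deg pi)) z)%qT.
Proof.
have p_cocycle (p : infinitesimalDeformation pi) :
    deform_coef p \in cocycles pi (deg pi).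
  by rewrite -(deformation_eq_cocycle charK); case: p.
have z_deform (z : cocycle pi (deg pi)) :
    (cocycle_val z \in homog V (deg pi)) &&
    (bracket V pi (cocycle_val z) + bracket V (cocycle_val z) pi == 0).
  by rewrite (deformation_eq_cocycle charK); case: z.
pose f p : cocycle pi (deg pi) := Cocycle (p_cocycle p).
pose g z : infinitesimalDeformation pi := InfinitesimalDeformation (z_deform z).
have f_bij : bijective f by exists g => ?; apply: val_inj.
have f_equiv p q :
    (\pi_(deformation_classes pi) p = \pi_(deformation_classes pi) q <->
     \pi_(cohomology pi (deg pi)) (f p) = \pi_(cohomology pi (deg pi)) (f q))%qT.
  have E : deform_equiv p q = (f p - f q \in @coboundaries _ _ _ pi (deg pi)).
    exact: deform_equiv_eq_coboundary.
  by split=> /eqP pq; apply/eqP; move: pq; rewrite !eqmodE /= E.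
have [Phi [Phi_bij PhiE]] := quotient_bijection _ _ f f_bij f_equiv.
by exists Phi; split=> // p; exists (f p).
Qed.
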